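(* Let $\mathit{LR}$ be the graded dual of $\mathcal{Y}Sym$ with basis $\{M^*_t\}$ dual to $\{M_t\}$. For any tree $t$, $$\Delta(M^*_t)=\sum_{\mathsf{S}}M^*_{t'_{\mathsf{S}}}\otimes M^*_{t''_{\mathsf{S}}},$$ the sum over all admissible subsets $\mathsf{S}$ of internal nodes of $t$.
   Context: $\mathcal{Y}_n$ = rooted planar binary trees with $n$ internal nodes, $\mathcal{Y}_0=\{|\}$; $s\vee t$ = tree whose root has left subtree $s$ and right subtree $t$; $t=t_l\vee t_r$ uniquely for $t\ne|$. Tamari order: generated by replacing a subtree $(a\vee b)\vee c$ by the larger $a\vee(b\vee c)$. $|\backslash t=t$, $s\backslash t=s_l\vee(s_r\backslash t)$ (graft the root of $t$ onto the rightmost leaf of $s$). Admissible sets: a subset $\mathsf{R}$ of internal nodes of a tree $r$ is admissible if for every $x\in\mathsf{R}$ the left child of $x$ (if internal) and all its internal descendants lie in $\mathsf{R}$. Prune $r$ by cutting every edge joining a node of $\mathsf{R}$ to a node not in $\mathsf{R}$. The pieces containing the nodes of $\mathsf{R}$ form planar binary trees $r_1,\dots,r_p$ (ordered left to right by the positions of their leaves in $r$), and $r'_{\mathsf{R}}:=r_1\backslash\cdots\backslash r_p$. The remaining pieces form a forest which is assembled into a tree $r''_{\mathsf{R}}$: whenever a piece $s$ lies above a piece $u$ with no intervening piece, the root of $s$ is grafted onto the unique leaf of $u$ below it; the piece containing the root of $r$ (or $|$ if all nodes are in $\mathsf{R}$) is at the bottom. Equivalently, recursively: for $r=|$, $r'=r''=|$;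 for $r=s\vee t$ with $\mathsf{S}=\mathsf{R}\cap s$, $\mathsf{T}=\mathsf{R}\cap t$: if the root of $r$ is in $\mathsf{R}$ (then all of $s$ is in $\mathsf{R}$), $r'_{\mathsf{R}}=s\vee t'_{\mathsf{T}}$ and $r''_{\mathsf{R}}=t''_{\mathsf{T}}$; otherwise $r'_{\mathsf{R}}=s'_{\mathsf{S}}\backslash t'_{\mathsf{T}}$ and $r''_{\mathsf{R}}=s''_{\mathsf{S}}\vee t''_{\mathsf{T}}$. $\mathcal{Y}Sym$ is the graded connected Hopf algebra over $\mathbb{Q}$ with basis $F_t$. Leaves of $t\in\mathcal{Y}_p$ are numbered $0..p$; splitting at leaf $i$, $t\to(t_0,t_1)$: $|\to(|,|)$; for $t=t_l\vee t_r$, $t\to(a,b\vee t_r)$ if leaf $i$ is in $t_l$ and $t_l\to(a,b)$, $t\to(t_l\vee c,d)$ if in $t_r$ and $t_r\to(c,d)$. $\Delta(F_t)=\sum_iF_{t_0}\otimes F_{t_1}$. For $s\in\mathcal{Y}_q$: $F_t\cdot F_s=\sum F_{(t_0,\dots,t_q)/s}$ over multisets $i_1\le\dots\le i_q$ of leaves of $t$, where $t\to(t_0,..,t_q)$ splits $t$ at $i_q$ into $(t',t_q)$ and divides $t'$ at $i_1,..,i_{q-1}$, and $(t_0,..,t_q)/s$ grafts the root of $t_i$ onto leaf $i$ of $s$. $M_t=\sum_{t\le s}\mu_{\mathcal{Y}_n}(t,s)F_s$. The coproduct of $\mathit{LR}$ is dual to the product of $\mathcal{Y}Sym$. *)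

(* Defs.v *)
From HB Require Import structures.
From mathcomp Require Import all_boot all_order all_algebra.
Set Implicit Arguments. Unset Strict Implicit. Unset Printing Implicit Defensive.
Import Order.TTheory GRing.Theory Num.Theory.
Local Open Scope ring_scope.

Inductive tree := Leaf | Node of tree & tree.

Fixpoint tree_eqb (s t : tree) : bool :=
  match s, t with
  | Leaf, Leaf => true
  | Node a b, Node c d => tree_eqb a c && tree_eqb b d
  | _, _ => false
  end.

Lemma tree_eqP : Equality.axiom tree_eqb.
Proof.
elim=> [|a IHa b IHb] [|c d] /=; try by constructor.
case: (IHa c) => [->|nac]; last by constructor; case.
case: (IHb d) => [->|nbd]; last by constructor; case.
by constructor.
Qed.

HB.instance Definition _ := hasDecEq.Build tree tree_eqP.

Fixpoint nodes (t : tree) : nat :=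
  match t with Leaf => 0%N | Node l r => (nodes l + nodes r).+1 end.

Fixpoint gen_trees (k : nat) : seq tree :=
  match k with
  | 0 => [:: Leaf]
  | k'.+1 => Leaf :: [seq Node lr.1 lr.2 |
                      lr <- [seq (l, r) | l <- gen_trees k', r <- gen_trees k']
                      & (nodes lr.1 + nodes lr.2 <= k')%N]
  end.

Definition trees_of (n : nat) : seq tree :=
  undup [seq t <- gen_trees n | nodes t == n].

Fixpoint rots (t : tree) : seq tree :=
  match t with
  | Leaf => [::]
  | Node l r =>
      (if l is Node a b then [:: Node a (Node b r)] else [::])
      ++ [seq Node l' r | l' <- rots l] ++ [seq Node l r' | r' <- rots r]
  end.

Definition rot_step (L : seq tree) : seq tree := undup (L ++ flatten (map rots L)).

(* t <= s in the Tamari order: s is reachable from t by rotations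
   (reflexive-transitive closure; #Y_n iterations suffice). *)
Definition tamari_le (t s : tree) : bool :=
  s \in iter (size (trees_of (nodes t))) rot_step [:: t].

Fixpoint mu_f (k : nat) (t s : tree) : rat :=
  match k with
  | 0 => 0
  | k'.+1 =>
      if s == t then 1
      else if tamari_le t s then
        - \sum_(r <- trees_of (nodes t) | tamari_le t r && tamari_le r s && (r != s))
            mu_f k' t r
      else 0
  end.

Definition mobius (t s : tree) : rat := mu_f (size (trees_of (nodes t))).+1 t s.

(* an element is a list of (coefficient, tree) pairs, read as sum c F_t *)
Definition ysym := seq (rat * tree).

Definition coefF (x : ysym) (s : tree) : rat :=
  \sum_(p <- x) (if p.2 == s then p.1 else 0).

Definition F (t : tree) : ysym := [:: (1, t)].

(* splitting t at leaf i (leaves numbered 0..nodes t from left to right) *)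
Fixpoint split (t : tree) (i : nat) : tree * tree :=
  match t with
  | Leaf => (Leaf, Leaf)
  | Node l r =>
      if (i <= nodes l)%N then let: (a, b) := split l i in (a, Node b r)
      else let: (c, d) := split r (i - (nodes l).+1) in (Node l c, d)
  end.

(* dividing t at leaves i_1 <= ... <= i_k: t -> (t_0, ..., t_k) *)
Fixpoint divide_from (off : nat) (t : tree) (ks : seq nat) : seq tree :=
  match ks with
  | [::] => [:: t]
  | i :: ks' => let: (a, b) := split t (i - off) in a :: divide_from i b ks'
  end.

Definition divide (t : tree) (ks : seq nat) : seq tree := divide_from 0 t ks.

Definition pieces (t : tree) (ms : seq nat) : seq tree :=
  match ms with
  | [::] => [:: t]
  | i1 :: rest =>
      let: (t', tq) := split t (last i1 rest) in rcons (divide t' (belast i1 rest)) tq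
  end.

Fixpoint graftl (s : tree) (ts : seq tree) : tree * seq tree :=
  match s with
  | Leaf => if ts is x :: xs then (x, xs) else (Leaf, [::])
  | Node l r =>
      let: (l', ts1) := graftl l ts in
      let: (r', ts2) := graftl r ts1 in (Node l' r', ts2)
  end.

Definition graft (ts : seq tree) (s : tree) : tree := (graftl s ts).1.

Fixpoint msets (q lo p : nat) : seq (seq nat) :=
  match q with
  | 0 => [:: [::]]
  | q'.+1 => flatten [seq [seq i :: m | m <- msets q' i p] | i <- iota lo (p.+1 - lo)]
  end.

(* F_t . F_s = sum over multisets of leaves of t of F_{(t_0,...,t_q)/s} *)
Definition Fprod (t s : tree) : seq tree :=
  [seq graft (pieces t ms) s | ms <- msets (nodes s) 0 (nodes t)].

Definition ymul (x y : ysym) : ysym :=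
  flatten [seq [seq (p.1 * q.1, c) | c <- Fprod p.2 q.2] | p <- x, q <- y].

Definition M (t : tree) : ysym :=
  [seq (mobius t s, s) | s <- [seq x <- trees_of (nodes t) | tamari_le t x]].

(* a subset of the internal nodes of a tree = the tree with a boolean mark
   on each internal node (true = in the subset) *)
Inductive mtree := MLeaf | MNode of bool & mtree & mtree.

Fixpoint shape (m : mtree) : tree :=
  match m with MLeaf => Leaf | MNode _ l r => Node (shape l) (shape r) end.

Fixpoint markings (t : tree) : seq mtree :=
  match t with
  | Leaf => [:: MLeaf]
  | Node l r => flatten [seq [seq MNode b ml mr | ml <- markings l, mr <- markings r] | b <- [:: true; false]]
  end.

Fixpoint all_marked (m : mtree) : bool :=
  match m with MLeaf => true | MNode b l r => [&& b, all_marked l & all_marked r] end.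

Fixpoint admissible (m : mtree) : bool :=
  match m with
  | MLeaf => true
  | MNode b l r => [&& b ==> all_marked l, admissible l & admissible r]
  end.

Fixpoint over (s t : tree) : tree :=
  match s with Leaf => t | Node sl sr => Node sl (over sr t) end.

Fixpoint prune (m : mtree) : tree * tree :=
  match m with
  | MLeaf => (Leaf, Leaf)
  | MNode b l r =>
      let: (l', l'') := prune l in
      let: (r', r'') := prune r in
      if b then (Node (shape l) r', r'') else (over l' r', Node l'' r'')
  end.

(* Main.v *)
(** With [F_t = sum_(s >= t) M_s], Möbius inversion reduces the theorem to: for
    all trees [u], [v], [t], the multisets of leaves of [u] whose grafting onto
    [v] is [<= t] are as many as the admissible subsets [S] of [t] with
    [u <= t'_S] and [v <= t''_S].  Number nodes in inorder.  A multiset amounts to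
    a word in [true] (node of [u]) and [false] (node of [v]), hence to a subset [S]
    of the nodes of [t], and for each single [S] the two conditions are
    equivalent.  This goes by recursion on [t], because [x <= Node l r] holds
    exactly when the node of [x] numbered [nodes l] lies on the left spine of [x]
    and, once it is rotated up to the root, its subtrees are [<= l] and [<= r];
    this rotation acts on a grafting by acting on [u] or on [v]. *)
Require Import Defs.
From mathcomp Require Import all_boot all_order all_algebra.
From mathcomp Require Import zify.
Import GRing.Theory Num.Theory.
(* A second import, since [split] and [shape] are also MathComp names. *)
Import Defs.
Set Implicit Arguments. Unset Strict Implicit. Unset Printing Implicit Defensive.

(** * Splitting trees and the Tamari order *)

Lemma split_Node l r i : split (Node l r) i =
  if i <= nodes l then ((split l i).1, Node (split l i).2 r)
  else (Node l (split r (i - (nodes l).+1)).1, (split r (i - (nodes l).+1)).2).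
Proof. by rewrite /=; case: ifP => _; case: (split _ _). Qed.

Local Arguments Defs.split : simpl never.

Lemma nodes_split u i : i <= nodes u ->
  nodes (split u i).1 = i /\ nodes (split u i).2 = nodes u - i.
Proof.
elim: u i => [|l IHl r IHr] i.
  by rewrite leqn0 => /eqP ->.
rewrite split_Node => le_i; rewrite /= in le_i *; case: leqP => le_il /=.
  by have [-> ->] := IHl _ le_il; lia.
by have [|-> ->] := IHr (i - (nodes l).+1); lia.
Qed.

Lemma split0 u : split u 0 = (Leaf, u).
Proof. by elim: u => [|l IHl r _] //; rewrite split_Node IHl. Qed.

(** Coassociativity of splitting: two cuts give the same three pieces in either order. *)
Lemma splitA u i j : j <= i -> i <= nodes u ->
  [/\ (split (split u i).1 j).1 = (split u j).1,
      (split (split u i).1 j).2 = (split (split u j).2 (i - j)).1 &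
      (split u i).2 = (split (split u j).2 (i - j)).2].
Proof.
elim: u i j => [|l IHl r IHr] i j le_ji.
  by rewrite leqn0 => /eqP ->.
rewrite !split_Node /= => le_i; case: (leqP i (nodes l)) => le_il.
  rewrite (leq_trans le_ji le_il) /= split_Node.
  have [nl nr] := nodes_split (leq_trans le_ji le_il).
  by rewrite nr leq_sub2r //=; have [-> -> ->] := IHl i j le_ji le_il.
rewrite split_Node; case: leqP => le_jl /=; rewrite ?split_Node.
  have [nl nr] := nodes_split le_jl.
  rewrite nr ifF; last by lia.
  by rewrite (_ : i - j - _ = i - (nodes l).+1) //; lia.
have [||-> -> ->] := IHr (i - (nodes l).+1) (j - (nodes l).+1); [lia|lia|].
by rewrite (_ : _ - _ - _ = i - j) //; lia.
Qed.

(* [lcut u b = Some (x, y)] iff the node numbered [b] in inorder lies on the left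
   spine of [u]; rotating it up to the root turns [u] into [Node x y]. *)
Fixpoint lcut (u : tree) (b : nat) : option (tree * tree) :=
  if u is Node l r then
    if b == nodes l then Some (l, r)
    else if b < nodes l then
      if lcut l b is Some (x, y) then Some (x, Node y r) else None
    else None
  else None.

Fixpoint tle (u t : tree) : bool :=
  match t with
  | Leaf => u == Leaf
  | Node l r => if lcut u (nodes l) is Some (x, y) then tle x l && tle y r
                else false
  end.

Lemma nodes_lcut u b x y : lcut u b = Some (x, y) ->
  nodes x = b /\ nodes u = (b + nodes y).+1.
Proof.
elim: u x y => [|l IHl r _] x y //=; case: eqVneq => [-> [<- <-] //|_].
case: ltnP => // lt_bl; case E : (lcut l b) => [[x' y']|] // [<- <-] /=.
by have [-> ->] := IHl _ _ E; lia.
Qed.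

Lemma nodes_tle u t : tle u t -> nodes u = nodes t.
Proof.
elim: t u => [|l IHl r IHr] u /=; first by move/eqP ->.
case E : (lcut u _) => [[x y]|] // /andP[/IHl nx /IHr <-].
by have [_ ->] := nodes_lcut E.
Qed.

(** Node [b] lies left of leaf [i], so the cut at [i] runs through [y] only. An ancestor having [b]
    in its right subtree is also left of [i]; it stays in the left piece and keeps [b] off the left
    spine. *)
Lemma lcut_split u i b : b < i -> i <= nodes u ->
  if lcut u b is Some (x, y) then
    lcut (split u i).1 b = Some (x, (split y (i - b.+1)).1) /\
    (split u i).2 = (split y (i - b.+1)).2
  else lcut (split u i).1 b = None.
Proof.
elim: u i b => [|l IHl r IHr] i b lt_bi; first by case: i lt_bi.
rewrite split_Node => /= le_i; case: (leqP i (nodes l)) => [le_il|lt_li] /=.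
  have lt_bl : b < nodes l by apply: leq_trans le_il.
  rewrite ltn_eqF // lt_bl.
  have := IHl i b lt_bi le_il; case E : (lcut l b) => [[x y]|] /=; last by move->.
  have [_ nl] := nodes_lcut E.
  rewrite split_Node ifT; last by lia.
  by case=> -> ->.
case: (eqVneq b (nodes l)) => [-> //|_]; case: ltnP => lt_bl //.
case E : (lcut l b) => [[x y]|] //=.
have [_ nl] := nodes_lcut E.
rewrite split_Node ifF; last by lia.
by rewrite (_ : i - b.+1 - _ = i - (nodes l).+1) //; lia.
Qed.

Lemma tle_refl t : tle t t.
Proof. by elim: t => //= l IHl r IHr; rewrite eqxx IHl. Qed.

(** Recursion down the right spine of [s]: by [lcut_split], rotating the node that matches the root
    of [s] up to the top commutes with the cut at leaf [nodes s]. *)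
Lemma tle_over u s t : nodes u = nodes s + nodes t ->
  tle u (over s t) = tle (split u (nodes s)).1 s && tle (split u (nodes s)).2 t.
Proof.
elim: s u => [|sl IHl sr IHr] u nu /=; first by rewrite split0.
have le_s : nodes sl + nodes sr < nodes u by rewrite nu /=; lia.
have lt_s : nodes sl < (nodes sl + nodes sr).+1 by lia.
have := lcut_split lt_s le_s; case E : (lcut u _) => [[x y]|]; last by move->.
have [nx ny] := nodes_lcut E; rewrite /= in nu.
rewrite subSS addKn => -[-> ->]; rewrite IHr -?andbA //; lia.
Qed.

(** * Rotations and chains of rotations *)

Definition rot : rel tree := fun t s => s \in rots t.

Lemma rotsP t s : reflect
  [\/ exists a b c, t = Node (Node a b) c /\ s = Node a (Node b c),
      exists l r l', [/\ t = Node l r, s = Node l' r & rot l l'] |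
      exists l r r', [/\ t = Node l r, s = Node l r' & rot r r']] (rot t s).
Proof.
apply: (iffP idP); rewrite /rot.
  case: t => [|l r] //=; rewrite !mem_cat => /or3P[].
  - by case: l => [|a b] //; rewrite inE => /eqP ->; constructor 1; exists a, b, r.
  - by case/mapP=> l' ? ->; constructor 2; exists l, r, l'.
  - by case/mapP=> r' ? ->; constructor 3; exists l, r, r'.
case=> [[a [b [c [-> ->]]]]|[l [r [l' [-> -> h]]]]|[l [r [r' [-> -> h]]]]] /=.
- by rewrite mem_head.
- by rewrite !mem_cat map_f ?orbT.
- by rewrite !mem_cat (map_f (Node l)) ?orbT.
Qed.

Lemma nodes_rot t s : rot t s -> nodes s = nodes t.
Proof.
elim: t s => [|l IHl r IHr] s // /rotsP[].
- by move=> [a [b [c [-> ->]]]] /=; lia.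
- by move=> [? [? [l' [[<- <-] -> /IHl h]]]] /=; rewrite h.
- by move=> [? [? [r' [[<- <-] -> /IHr h]]]] /=; rewrite h.
Qed.

(** The sizes of the right subtrees, summed over all nodes. Every rotation raises this sum strictly,
    which yields antisymmetry of the order and the induction in [zeta_inj]. *)
Fixpoint right_weight (t : tree) : nat :=
  if t is Node l r then nodes r + right_weight l + right_weight r else 0.

Lemma right_weight_rot t s : rot t s -> right_weight t < right_weight s.
Proof.
elim: t s => [|l IHl r IHr] s // /rotsP[].
- by move=> [a [b [c [-> ->]]]] /=; lia.
- by move=> [? [? [l' [[<- <-] -> /IHl h]]]] /=; lia.
- by move=> [? [? [r' [[<- <-] -> h]]]] /=; rewrite (nodes_rot h); have := IHr _ h; lia.
Qed.

(** A rotation can only remove nodes from the left spine. Bringing node [b] to the root either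
    absorbs the rotation or leaves it as a rotation inside one of the two subtrees. *)
Lemma lcut_rot t t' b x' y' : rot t t' -> lcut t' b = Some (x', y') ->
  exists x y, lcut t b = Some (x, y) /\
    [\/ x = x' /\ y = y', rot x x' /\ y = y' | x = x' /\ rot y y'].
Proof.
elim: t t' b x' y' => [|l IHl r IHr] t' b x' y' // /rotsP[].
- move=> [a [c [d [-> ->]]]] /=.
  case: (eqVneq b (nodes a)) => [-> [<- <-]|ne].
    exists a, (Node c d); rewrite ltn_eqF ?ltnS ?leq_addr //.
    by split=> //; constructor.
  case: ltnP => // lt_b; case E : (lcut a b) => [[x y]|] // -[<- <-].
  exists x, (Node (Node y c) d); rewrite ltn_eqF; last by lia.
  rewrite ifT; last by lia.
  by split=> //; constructor 3; split=> //; apply/rotsP; constructor 1; exists y, c, d.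
- move=> [? [? [l' [[<- <-] -> h]]]] /=; rewrite (nodes_rot h).
  case: (eqVneq b (nodes l)) => [_ [<- <-]|ne].
    by exists l, r; split=> //; constructor 2.
  case: ltnP => // lt_b; case E : (lcut l' b) => [[x y]|] // -[<- <-].
  have [x0 [y0 [-> o]]] := IHl _ _ _ _ h E.
  exists x0, (Node y0 r); split=> //; case: o => -[].
  + by move=> -> ->; constructor.
  + by move=> ? ->; constructor 2.
  + move=> -> hy; constructor 3; split=> //; apply/rotsP; constructor 2.
    by exists y0, r, y.
- move=> [? [? [r' [[<- <-] -> h]]]] /=.
  case: (eqVneq b (nodes l)) => [_ [<- <-]|ne].
    by exists l, r; split=> //; constructor 3.
  case: ltnP => // lt_b; case E : (lcut l b) => [[x y]|] // -[<- <-].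
  exists x, (Node y r); split=> //; constructor 3; split=> //.
  by apply/rotsP; constructor 3; exists y, r, r'.
Qed.

Lemma rot_tle t t' s : rot t t' -> tle t' s -> tle t s.
Proof.
elim: s t t' => [|l IHl r IHr] t t' h /=.
  by move/eqP=> E; move: (nodes_rot h); rewrite E; case: t {h}.
case E : (lcut t' _) => [[x' y']|] // /andP[hl hr].
have [x [y [-> []]]] := lcut_rot h E.
- by case=> -> ->; rewrite hl.
- by case=> hx ->; rewrite (IHl _ _ hx hl).
- by case=> -> hy; rewrite hl (IHr _ _ hy hr).
Qed.

Definition rot_path t s := exists2 p, path rot t p & last t p = s.

Lemma rot_path_refl t : rot_path t t.
Proof. by exists [::]. Qed.

Lemma rot_path1 t s : rot t s -> rot_path t s.
Proof. by exists [:: s]; rewrite //= andbT. Qed.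

Lemma rot_path_trans s t r : rot_path t s -> rot_path s r -> rot_path t r.
Proof.
move=> [p hp <-] [q hq <-]; exists (p ++ q); last by rewrite last_cat.
by rewrite cat_path hp.
Qed.

Lemma rot_path_Node l l' r r' :
  rot_path l l' -> rot_path r r' -> rot_path (Node l r) (Node l' r').
Proof.
move=> [p hp <-] [q hq <-]; apply: (@rot_path_trans (Node (last l p) r)).
  elim: p l hp {q hq} => [|x p IHp] l /= => [_|/andP[hx /IHp]].
    exact: rot_path_refl.
  apply: rot_path_trans; apply: rot_path1; apply/rotsP; constructor 2.
  by exists l, r, x.
elim: q r hq => [|x q IHq] r /= => [_|/andP[hx /IHq]].
  exact: rot_path_refl.
apply: rot_path_trans; apply: rot_path1; apply/rotsP; constructor 3.
by exists (last l p), r, x.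
Qed.

Lemma rot_path_lcut u b x y : lcut u b = Some (x, y) -> rot_path u (Node x y).
Proof.
elim: u x y => [|l IHl r _] x y //=.
case: eqVneq => [_ [<- <-]|_]; first exact: rot_path_refl.
case: ltnP => // lt_bl; case E : (lcut l b) => [[x' y']|] // [<- <-] /=.
apply: (@rot_path_trans (Node (Node x' y') r)).
  by apply: rot_path_Node (rot_path_refl _); apply: IHl.
by apply: rot_path1; apply/rotsP; constructor 1; exists x', y', r.
Qed.

(** A chain is followed backwards from [s] by [rot_tle]. Conversely, [rot_path_lcut] rotates the
    right node up to the root, and the two subtrees are then treated separately. *)
Lemma tleP t s : reflect (rot_path t s) (tle t s).
Proof.
apply: (iffP idP) => [|[p]]; last first.
  elim: p t => [|x p IHp] t /= => [_ ->|/andP[hx hp] e]; first exact: tle_refl.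
  by apply: rot_tle hx _; apply: IHp.
elim: s t => [|l IHl r IHr] t /=; first by move/eqP->; exact: rot_path_refl.
case E : (lcut t _) => [[x y]|] // /andP[/IHl hl /IHr hr].
exact: rot_path_trans (rot_path_lcut E) (rot_path_Node hl hr).
Qed.

Lemma tle_trans : transitive tle.
Proof. by move=> s t r /tleP ts /tleP sr; apply/tleP; apply: rot_path_trans sr. Qed.

Lemma right_weight_tle t s : tle t s -> t != s -> right_weight t < right_weight s.
Proof.
move/tleP=> [p + <-] {s}; elim: p t => [|x p IHp] t /=; first by rewrite eqxx.
move=> /andP[/right_weight_rot ltx /IHp hp] _.
by have [<-//|/hp] := eqVneq x (last x p); apply: ltn_trans.
Qed.

(** * Enumeration of trees and agreement of the two forms of the order *)

Lemma mem_gen_trees k t : (t \in gen_trees k) = (nodes t <= k).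
Proof.
elim: k t => [|k IHk] [|l r] //=.
rewrite inE /=; apply/mapP/idP.
  move=> [[l' r']]; rewrite mem_filter => /andP[/= h _] [-> ->]; exact: h.
rewrite ltnS => h; exists (l, r) => //; rewrite mem_filter h /=.
by apply/allpairsP; exists (l, r); rewrite !IHk; split=> //=; lia.
Qed.

Lemma mem_trees_of n t : (t \in trees_of n) = (nodes t == n).
Proof.
by rewrite mem_undup mem_filter mem_gen_trees; case: eqP => // ->; rewrite leqnn.
Qed.

Lemma uniq_trees_of n : uniq (trees_of n).
Proof. exact: undup_uniq. Qed.

Lemma mem_rot_step L s :
  reflect (s \in L \/ exists2 t, t \in L & rot t s) (s \in rot_step L).
Proof.
rewrite mem_undup mem_cat; apply: (iffP orP).
  case=> h; first by left.
  by case/flattenP: h => x /mapP[t tL ->] ?; right; exists t.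
case=> [|[t tL h]]; [by left|right]; apply/flattenP; exists (rots t); rewrite ?map_f //.
Qed.

Lemma rot_step_iterP k t s :
  reflect (exists p, [/\ path rot t p, last t p = s & size p <= k])
          (s \in iter k rot_step [:: t]).
Proof.
elim: k s => [|k IHk] s /=.
  rewrite inE; apply: (iffP eqP) => [->|[[|x p] [_ <-]//]].
  by exists [::].
apply: (iffP (mem_rot_step _ _)).
  move=> [/IHk[p [hp e le]]|[r /IHk[p [hp e le]] rs]].
    by exists p; split=> //; apply: leqW.
  by exists (rcons p s); rewrite rcons_path hp e last_rcons size_rcons.
move=> [p]; case/lastP: p => [|p x] [hp e le].
  by left; apply/IHk; exists [::].
move: hp e le; rewrite rcons_path last_rcons size_rcons => /andP[hp hx] <- le.
by right; exists (last t p) => //; apply/IHk; exists p.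
Qed.

Lemma tamari_leE t s : tamari_le t s = tle t s.
Proof.
apply/rot_step_iterP/tleP => [[p [hp e _]]|[p hp <-]]; first by exists p.
(* A chain without repetition visits distinct trees with [nodes t] nodes, so their number bounds its
   length; this bound is the iteration count in [tamari_le]. *)
case/shortenP: hp => p' hp' up' _; exists p'; split=> //.
suff sub : {subset t :: p' <= trees_of (nodes t)}.
  exact: ltnW (uniq_leq_size up' sub).
elim: p' t hp' {up'} => [|x p' IHp] t /=.
  by move=> _ y; rewrite inE => /eqP ->; rewrite mem_trees_of.
move=> /andP[hx hp'] y; rewrite inE => /orP[/eqP->|]; first by rewrite mem_trees_of.
by rewrite -(nodes_rot hx); apply: IHp.
Qed.

(** * Graftings along a word *)

(* [g] is the grafting of the pieces of [u] onto [v], where [w] reads off the nodes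
   of [g] in inorder: [true] for those of [u], [false] for those of [v]. *)
Inductive grafted : tree -> tree -> seq bool -> tree -> Prop :=
| GraftedLeaf u : grafted u Leaf (nseq (nodes u) true) u
| GraftedNode u vl vr w1 w2 g1 g2 of count id w1 <= nodes u
    & grafted (split u (count id w1)).1 vl w1 g1
    & grafted (split u (count id w1)).2 vr w2 g2 :
    grafted u (Node vl vr) (w1 ++ false :: w2) (Node g1 g2).

Lemma grafted_nodes u v w g : grafted u v w g ->
  [/\ count id w = nodes u, count negb w = nodes v & nodes g = size w].
Proof.
elim=> {u v w g} [u|u vl vr w1 w2 g1 g2 le1 _ [c1 d1 n1] _ [c2 d2 n2]].
  by rewrite !count_nseq size_nseq mul1n mul0n.
have [_ nr] := nodes_split le1.
rewrite !count_cat size_cat /= d1 d2 n1 n2 c2 nr; split; lia.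
Qed.

Lemma all_true_nseq w : all id w -> w = nseq (size w) true.
Proof. by elim: w => //= b w IHw /andP[-> /IHw <-]. Qed.

(** A node of [u] preceded by a node of [v] lies in some right subtree, hence off the left spine;
    otherwise the rotation takes place in [u], and [y] is what remains to be grafted onto [v]. For a
    node of [v] the rotation takes place in [v], and [u] is cut at the leaf reached there. *)
Lemma grafted_lcut u v w g wl b wr :
    grafted u v w g -> w = wl ++ b :: wr ->
  if b then
    if all id wl then
      if lcut u (size wl) is Some (x, y) then
        exists2 g', lcut g (size wl) = Some (x, g') & grafted y v wr g'
      else lcut g (size wl) = None
    else lcut g (size wl) = None
  else
    if lcut v (count negb wl) is Some (x, y) then
      exists gx gy, [/\ lcut g (size wl) = Some (gx, gy),
        grafted (split u (count id wl)).1 x wl gx &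
        grafted (split u (count id wl)).2 y wr gy]
    else lcut g (size wl) = None.
Proof.
move=> gr; elim: gr wl b wr => {u v w g} [u|u vl vr w1 w2 g1 g2 le1].
  move=> wl b wr e.
  have : all id (wl ++ b :: wr) by rewrite -e all_nseq orbT.
  rewrite all_cat /= => /and3P[awl -> awr]; rewrite awl.
  case E : (lcut u _) => [[x y]|] //; exists y => //.
  have [_ nu] := nodes_lcut E.
  have := congr1 size e; rewrite size_nseq size_cat /= nu => n.
  rewrite (all_true_nseq awr) (_ : size wr = nodes y); last by lia.
  exact: GraftedLeaf.
move=> gr1 IH1 gr2 IH2 wl b wr e.
have [c1 d1 n1] := grafted_nodes gr1.
have [c2 d2 n2] := grafted_nodes gr2.
(* The root of [v] has number [size w1] in the grafting, so the node is in the left subtree, in the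
   right subtree, or is that root. *)
case: (ltngtP (size wl) (size w1)) => [lt|lt|eq].
- have [w1' ew1 ewr] : exists2 w1', w1 = wl ++ b :: w1' & wr = w1' ++ false :: w2.
    have := congr1 (drop (size wl)) e; rewrite drop_cat lt drop_size_cat //.
    have := congr1 (take (size wl)) e; rewrite take_cat lt take_size_cat //.
    move=> tw; case ew : (drop (size wl) w1) => [|b' w1'] /=.
      by have := size_drop (size wl) w1; rewrite ew /=; lia.
    by move=> [eb <-]; exists w1'; rewrite // -tw -eb -ew cat_take_drop.
  have := IH1 _ _ _ ew1; rewrite ewr {e}.
  rewrite /= n1 (ltn_eqF lt) lt.
  case: b ew1 => ew1.
    case: ifP => awl; last by move->.
    have cwl : count id wl = size wl by apply/eqP; rewrite -all_count.
    have lt_c : size wl < count id w1 by rewrite ew1 count_cat /= cwl; lia.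
    have := lcut_split lt_c le1; case E : (lcut u _) => [[x y]|]; last by move=> -> ->.
    have -> : count id w1 - (size wl).+1 = count id w1'.
      by rewrite ew1 count_cat /= cwl; lia.
    move=> [-> e2] [g' -> gr']; exists (Node g' g2) => //.
    apply: GraftedNode; rewrite -?e2 //.
    have [_ nu] := nodes_lcut E.
    by move: le1; rewrite nu ew1 count_cat /= cwl; lia.
  have lec : count negb wl < nodes vl by rewrite -d1 ew1 count_cat /=; lia.
  rewrite /= (ltn_eqF lec) lec.
  case: (lcut vl _) => [[x y]|]; last by move->.
  move=> [gx [gy [-> grx gry]]]; exists gx, (Node gy g2).
  have lej : count id wl <= count id w1 by rewrite ew1 count_cat leq_addr.
  (* The left piece of [u] is cut a second time, whereas a grafting onto [Node y vr] cuts the right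
     piece left by the earlier leaf. *)
  have [e1 e2 e3] := splitA lej le1.
  have ec : count id w1 - count id wl = count id w1' by rewrite ew1 count_cat /=; lia.
  rewrite -e1; split=> //; apply: GraftedNode; rewrite -?ec -?e2 -?e3 //.
  have [_ ->] := nodes_split (leq_trans lej le1); exact: leq_sub2r.
- have -> : lcut (Node g1 g2) (size wl) = None.
    by rewrite /= n1 gtn_eqF // ltnNge ltnW.
  have [w1' ewl] : exists w1', wl = w1 ++ false :: w1'.
    have := congr1 (take (size wl)) e; rewrite take_cat take_size_cat //.
    rewrite ltnNge ltnW //=; case ew : (size wl - size w1) => [|k]; first by lia.
    by move=> <-; exists (take k w2).
  case: b e => _; first by rewrite ewl all_cat /= andbF.
  rewrite /= -d1 ewl count_cat /= gtn_eqF; last by lia.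
  by rewrite ifF //; lia.
- have /eqP := e; rewrite eqseq_cat // => /andP[/eqP <-] /eqP [<- <-].
  by rewrite d1 /= n1 !eqxx; exists g1, g2.
Qed.

(** * Marked trees, pruning, and the comparison for a single marking *)

Fixpoint inorder (m : mtree) : seq bool :=
  if m is MNode b l r then inorder l ++ b :: inorder r else [::].

Lemma size_inorder m : size (inorder m) = nodes (shape m).
Proof. by elim: m => //= b l IHl r IHr; rewrite size_cat /= IHl IHr addnS. Qed.

Lemma all_markedE m : all_marked m = all id (inorder m).
Proof.
by elim: m => //= b l -> r ->; rewrite all_cat /= andbCA.
Qed.

Lemma all_marked_admissible m : all_marked m -> admissible m.
Proof.
by elim: m => //= b l IHl r IHr /and3P[_ al /IHr->]; rewrite IHl // al implybT.
Qed.

Lemma nodes_prune m : admissible m ->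
  nodes (prune m).1 = count id (inorder m) /\
  nodes (prune m).2 = count negb (inorder m).
Proof.
have nodes_over s t : nodes (over s t) = nodes s + nodes t.
  by elim: s => //= a _ b ->; rewrite addSn addnA.
elim: m => //= b l IHl r IHr /and3P[bl /IHl + /IHr]; rewrite !count_cat /=.
case: (prune l) (prune r) => l' l'' [r' r''] /= [n1 n2] [n3 n4].
case: b bl => /=; last by rewrite nodes_over n1 n2 n3 n4 => _; split; lia.
rewrite all_markedE => al; rewrite -size_inorder n3 n4.
have cid : count id (inorder l) = size (inorder l) by apply/eqP; rewrite -all_count.
have cneg : count id (inorder l) + count negb (inorder l) = size (inorder l).
  exact: count_predC.
have -> : count negb (inorder l) = 0 by lia.
by rewrite cid; split; lia.
Qed.

(** At the root of [m], [grafted_lcut] mirrors the recursion of [prune]. For a marked root, its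
    condition that all earlier letters be [true] is admissibility there; for an unmarked root, the
    two pieces of [u] are compared with [over l' r'] through [tle_over]. *)
Lemma tle_grafted m u v g : grafted u v (inorder m) g ->
  tle g (shape m) = [&& admissible m, tle u (prune m).1 & tle v (prune m).2].
Proof.
elim: m u v g => [|b l IHl r IHr] u v g gr /=.
  have [/= nu nv ng] := grafted_nodes gr.
  by case: u v g nu nv ng {gr} => [|? ?] [|? ?] [|? ?].
have := grafted_lcut gr erefl; rewrite size_inorder -all_markedE.
have [cu cv _] := grafted_nodes gr; move: cu cv; rewrite /= !count_cat /=.
case El : (prune l) => [l' l''].
case Er : (prune r) => [r' r''].
case: b gr => /= _ cu cv.
  case: (boolP (all_marked l)) => al; last by move->.
  rewrite (all_marked_admissible al) /=.
  case: (lcut u _) => [[x y]|]; last by move->; rewrite !andbF.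
  by case=> g' -> /IHr ->; rewrite Er /= -!andbA andbCA.
(* The size condition of [tle_over] comes from [nodes_prune], which assumes admissibility;
   inadmissible subtrees are therefore settled first. *)
case: (boolP (admissible l)) => adl /=; last first.
  case: (lcut v _) => [[x y]|]; last by move->.
  by move=> [gx [gy [-> /IHl -> _]]]; rewrite (negbTE adl).
have [nl1 nl2] := nodes_prune adl; rewrite El /= in nl1 nl2.
case: (boolP (admissible r)) => adr /=; last first.
  case: (lcut v _) => [[x y]|]; last by move->.
  by move=> [gx [gy [-> _ /IHr ->]]]; rewrite (negbTE adr) andbF.
have [nr1 nr2] := nodes_prune adr; rewrite Er /= in nr1 nr2.
rewrite tle_over; last by lia.
rewrite nl1 nl2; case: (lcut v _) => [[x y]|]; last by move->; rewrite andbF.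
move=> [gx [gy [-> /IHl -> /IHr ->]]]; rewrite adl adr El Er /=.
by rewrite -!andbA; congr andb; rewrite andbCA.
Qed.

(** * Multisets of leaves, words and markings *)

(* Each node of [v] contributes the leaf of [u] at which [u] is split there, i.e.
   the number of nodes of [u] before it. *)
Fixpoint mset_of (off : nat) (w : seq bool) : seq nat :=
  if w is b :: w' then
    if b then mset_of off.+1 w' else off :: mset_of off w'
  else [::].

Lemma mset_of_cat off w1 w2 :
  mset_of off (w1 ++ w2) = mset_of off w1 ++ mset_of (off + count id w1) w2.
Proof.
elim: w1 off => [|[] w1 IHw] off /=; first by rewrite addn0.
  by rewrite IHw add1n addSnnS.
by rewrite IHw add0n.
Qed.

Lemma mset_of_all off w : all id w -> mset_of off w = [::].
Proof. by elim: w off => //= -[] w IHw off //=; apply: IHw. Qed.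

Lemma size_mset_of off w : size (mset_of off w) = count negb w.
Proof. by elim: w off => //= -[] w IHw off //=; rewrite IHw. Qed.

Lemma path_mset_of off w : path leq off (mset_of off w).
Proof.
elim: w off => //= -[] w IHw off /=; last by rewrite leqnn IHw.
by apply: path_le (leqnSn _) (IHw _); apply: leq_trans.
Qed.

Lemma mset_of_le off w : all (fun i => i <= off + count id w) (mset_of off w).
Proof.
elim: w off => //= -[] w IHw off /=; first by rewrite add1n -addSnnS.
by rewrite leq_addr IHw.
Qed.

(** The first letter can be read off: after a [true] every entry exceeds [off], while a [false] puts
    [off] in front. Trailing [true] letters leave no entry, and the common count recovers them. *)
Lemma mset_of_inj off w w' : count id w = count id w' ->
  mset_of off w = mset_of off w' -> w = w'.
Proof.
have mset_of_gt o v : o \notin mset_of o.+1 v.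
  apply/negP => /(allP (order_path_min leq_trans (path_mset_of _ v))).
  by rewrite ltnn.
elim: w w' off => [|[] w IHw] [|[] w'] off //= cw.
- by move/(IHw _ _ (addnI cw)) ->.
- by move=> e; have := mset_of_gt off w; rewrite e mem_head.
- by move=> e; have := mset_of_gt off w'; rewrite -e mem_head.
- by case=> /(IHw _ _ cw) ->.
Qed.

(** Iterated [splitA]: any one of the cuts may be made first. *)
Lemma divide_from_split off u ms i ms' : path leq off (ms ++ i :: ms') ->
    i <= off + nodes u ->
  divide_from off u (ms ++ i :: ms') =
  divide_from off (split u (i - off)).1 ms ++
  divide_from i (split u (i - off)).2 ms'.
Proof.
elim: ms off u => [|j ms IHms] off u /=; first by case: (split u _).
move=> /andP[le_oj hp] le_i.
have le_ji : j <= i.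
  by have := order_path_min leq_trans hp; rewrite all_cat /= => /and3P[].
have [|e1 e2 e3] := @splitA u (i - off) (j - off) (leq_sub2r off le_ji); first by lia.
have [|_ nr] := @nodes_split u (j - off); first by lia.
move: e1 e2 e3 nr; rewrite (surjective_pairing (split (split u (i - off)).1 _)).
rewrite (surjective_pairing (split u (j - off))) /= => -> -> -> nr.
rewrite IHms //; last by rewrite nr; lia.
by rewrite (_ : i - off - _ = i - j) //; lia.
Qed.

(** [pieces] makes the last cut first, [divide] goes from left to right; [divide_from_split] at the
    last leaf reconciles them. *)
Lemma pieces_divide u ms : sorted leq ms -> all (fun i => i <= nodes u) ms ->
  pieces u ms = divide u ms.
Proof.
case: ms => // i ms srt le_ms; rewrite /pieces.
have : path leq 0 (i :: ms) := srt.
have le_last : last i ms <= nodes u by apply: (allP le_ms); apply: mem_last.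
rewrite lastI -cats1 /divide => hp; rewrite divide_from_split // subn0 /=.
by case: (split u _) => a b; rewrite cats1.
Qed.

Lemma count_negb_split n w : n < count negb w ->
  exists w1 w2, w = w1 ++ false :: w2 /\ count negb w1 = n.
Proof.
elim: w n => //= -[] w IHw n /=.
  by move=> /IHw[w1 [w2 [-> <-]]]; exists (true :: w1), w2.
case: n => [_|n]; first by exists [::], w.
by rewrite ltnS => /IHw[w1 [w2 [-> <-]]]; exists (false :: w1), w2.
Qed.

(** The list [ts] stands for the pieces passed on to later leaves, and [off] keeps the leaf numbers
    of the undivided tree; both vary in the induction on [v]. *)
Lemma graftl_divide off u v w ts :
    count id w = nodes u -> count negb w = nodes v ->
  exists g, graftl v (divide_from off u (mset_of off w) ++ ts) = (g, ts)
            /\ grafted u v w g.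
Proof.
elim: v off u w ts => [|vl IHl vr IHr] off u w ts cu cv.
  have aw : all id w.
    have := count_predC id w; rewrite all_count -[count (predC _) _]/(count negb _).
    by rewrite cv addn0 => ->.
  exists u; rewrite mset_of_all //=; split=> //.
  rewrite (all_true_nseq aw) (_ : size w = nodes u); first exact: GraftedLeaf.
  by rewrite -cu; apply/esym/eqP; rewrite -all_count.
(* The root of [v] is the [false] with exactly [nodes vl] others before it. *)
have [|w1 [w2 [ew c1]]] := @count_negb_split (nodes vl) w; first by rewrite cv /=; lia.
have hp := path_mset_of off w; move: cu cv hp; rewrite ew !count_cat /= => cu cv.
rewrite mset_of_cat /= => hp; rewrite divide_from_split //; last by lia.
have le1 : count id w1 <= nodes u by lia.
have [n1 n2] := nodes_split le1; rewrite addKn -catA.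
have [|g1 [-> gr1]] := IHl off (split u (count id w1)).1 w1
  (divide_from (off + count id w1) (split u (count id w1)).2
     (mset_of (off + count id w1) w2) ++ ts) _ c1; first by rewrite n1.
have [||g2 [-> gr2]] := IHr (off + count id w1) (split u (count id w1)).2 w2 ts.
- by rewrite n2; lia.
- by lia.
by exists (Node g1 g2); split=> //; apply: GraftedNode.
Qed.

Lemma grafted_pieces u v w : count id w = nodes u -> count negb w = nodes v ->
  grafted u v w (graft (pieces u (mset_of 0 w)) v).
Proof.
move=> cu cv; have [g] := graftl_divide 0 [::] cu cv; rewrite cats0 => -[e gr].
rewrite pieces_divide; first by rewrite /graft /divide e.
  exact: path_sorted (path_mset_of 0 w).
by have := mset_of_le 0 w; rewrite cu.
Qed.

Lemma mem_msets q lo p ms : (ms \in msets q lo p) =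
  [&& size ms == q, path leq lo ms & all (fun i => i <= p) ms].
Proof.
elim: q lo ms => [|q IHq] lo ms /=; first by case: ms.
apply/allpairsPdep/idP => [[i [m [hi]]]|].
  rewrite IHq => /and3P[/eqP <- hp am] ->; move: hi; rewrite mem_iota => hi.
  by apply/and3P; split; rewrite //=; apply/andP; split=> //; lia.
case: ms => // i m /and3P[sz /andP[lei hp] /andP[lep am]]; exists i, m; split=> //.
  by rewrite mem_iota; lia.
by rewrite IHq; apply/and3P.
Qed.

Lemma uniq_msets q lo p : uniq (msets q lo p).
Proof.
elim: q lo => [|q IHq] lo //=; apply: allpairs_uniq_dep => //.
  exact: iota_uniq.
by move=> [i m] [j m'] /= _ _ [-> ->].
Qed.

Lemma map_inorder_markings l r :
  map inorder (markings (Node l r)) =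
  [seq wl ++ true :: wr | wl <- map inorder (markings l), wr <- map inorder (markings r)]
  ++ [seq wl ++ false :: wr | wl <- map inorder (markings l), wr <- map inorder (markings r)].
Proof.
by rewrite /= cats0 map_cat !map_allpairs !allpairs_mapl !allpairs_mapr.
Qed.

(** Together with [uniq_map_inorder], this makes inorder reading a bijection between subsets of
    nodes and words. The letter at position [nodes l] is the mark of the root. *)
Lemma mem_map_inorder t w : (w \in map inorder (markings t)) = (size w == nodes t).
Proof.
elim: t w => [|l IHl r IHr] w; first by case: w.
rewrite map_inorder_markings mem_cat; apply/orP/eqP => [h|sw].
  have [b h'] : exists b, w \in [seq wl ++ b :: wr | wl <- map inorder (markings l),
      wr <- map inorder (markings r)] by case: h => h; [exists true|exists false].
  case/allpairsP: h' => -[wl wr] /=; rewrite IHl IHr => -[/eqP sl /eqP sr ->].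
  by rewrite size_cat /= sl sr addnS.
have lt : nodes l < size w by rewrite sw /=; lia.
have ew := cat_take_drop (nodes l) w; rewrite (drop_nth false lt) in ew.
suff h b : nth false w (nodes l) = b -> w \in [seq wl ++ b :: wr |
    wl <- map inorder (markings l), wr <- map inorder (markings r)].
  by case E : (nth false w (nodes l)); [left|right]; apply: h.
move=> eb; apply/allpairsP; exists (take (nodes l) w, drop (nodes l).+1 w).
by rewrite IHl IHr size_take size_drop lt eqxx -eb; split=> //=; rewrite sw /=; lia.
Qed.

Lemma uniq_map_inorder t : uniq (map inorder (markings t)).
Proof.
elim: t => // l IHl r IHr; rewrite map_inorder_markings.
have cat_inj b b' wl wr wl' wr' : wl \in map inorder (markings l) ->
    wl' \in map inorder (markings l) -> wl ++ b :: wr = wl' ++ b' :: wr' ->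
    [/\ wl = wl', b = b' & wr = wr'].
  rewrite !mem_map_inorder => /eqP sl /eqP sl' /eqP.
  by rewrite eqseq_cat ?sl ?sl' // => /andP[/eqP -> /eqP[-> ->]].
have inj b : uniq [seq wl ++ b :: wr | wl <- map inorder (markings l),
    wr <- map inorder (markings r)].
  apply: allpairs_uniq => //.
  move=> _ _ /allpairsP[[wl wr] [/= hl _ ->]] /allpairsP[[wl' wr'] [/= hl' _ ->]] /= e.
  by have [-> _ ->] := cat_inj _ _ _ _ _ _ hl hl' e.
rewrite cat_uniq !inj andbT; apply/hasPn => w.
case/allpairsP=> -[wl wr] [/= hl _ ->]; apply/negP => /allpairsP[[wl' wr'] [/= hl' _ e]].
by have [_] := cat_inj _ _ _ _ _ _ hl hl' e.
Qed.

(** Inverse of [mset_of lo]: successive differences give the runs of [true], and [p] fixes the last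
    run. *)
Fixpoint word_of (lo p : nat) (ms : seq nat) : seq bool :=
  if ms is i :: ms' then nseq (i - lo) true ++ false :: word_of i p ms'
  else nseq (p - lo) true.

Lemma mset_ofK lo p ms : lo <= p -> path leq lo ms -> all (fun i => i <= p) ms ->
  [/\ mset_of lo (word_of lo p ms) = ms, count id (word_of lo p ms) = p - lo &
      count negb (word_of lo p ms) = size ms].
Proof.
have true_id n : all id (nseq n true) by rewrite all_nseq orbT.
elim: ms lo => [|i ms IHms] lo lep /=.
  by rewrite mset_of_all // !count_nseq mul1n mul0n.
move=> /andP[lei hp] /andP[leip am]; have [e1 e2 e3] := IHms i leip hp am.
rewrite mset_of_cat mset_of_all //= !count_cat !count_nseq /= mul1n mul0n e2 e3.
by rewrite subnKC // e1; split=> //; lia.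
Qed.

Lemma perm_msets t p q : nodes t = p + q ->
  perm_eq (msets q 0 p)
    [seq mset_of 0 w | w <- map inorder (markings t) & count id w == p].
Proof.
move=> nt; apply: uniq_perm; first exact: uniq_msets.
  rewrite map_inj_in_uniq ?filter_uniq ?uniq_map_inorder // => w w'.
  rewrite !mem_filter => /andP[/eqP cw _] /andP[/eqP cw' _]; apply: mset_of_inj.
  by rewrite cw.
have negbE w : count id w + count negb w = size w := count_predC id w.
move=> ms; rewrite mem_msets; apply/and3P/mapP.
  move=> [/eqP sz hp am]; have [e1 e2 e3] := mset_ofK (leq0n p) hp am.
  exists (word_of 0 p ms); rewrite ?e1 // mem_filter mem_map_inorder -negbE.
  by rewrite e2 e3 sz nt subn0 !eqxx.
move=> [w]; rewrite mem_filter mem_map_inorder => /andP[/eqP cw /eqP sw] ->.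
have := mset_of_le 0 w; rewrite cw path_mset_of size_mset_of => ->; split=> //.
by have := negbE w; rewrite cw sw nt => /addnI ->.
Qed.

Lemma eq_count_all (T : Type) (a p1 p2 : pred T) s :
  all a s -> (forall x, a x -> p1 x = p2 x) -> count p1 s = count p2 s.
Proof.
by move=> + e; elim: s => //= x s IHs /andP[/e -> /IHs ->].
Qed.

Lemma shape_markings t : all (fun m => shape m == t) (markings t).
Proof.
elim: t => // l IHl r IHr; rewrite /= cats0 all_cat.
have h b : all (fun m => shape m == Node l r)
    [seq MNode b ml mr | ml <- markings l, mr <- markings r].
  elim: (markings l) IHl => //= ml s IHs /andP[/eqP el /IHs h].
  rewrite all_cat h andbT all_map; apply: sub_all IHr => mr /= /eqP er.
  by rewrite el er.
by rewrite !h.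
Qed.

Lemma count_tle_graft u v t : nodes t = nodes u + nodes v ->
  count (fun ms => tle (graft (pieces u ms) v) t) (msets (nodes v) 0 (nodes u)) =
  count (fun m => [&& admissible m, tle u (prune m).1 & tle v (prune m).2])
    (markings t).
Proof.
move=> nt; rewrite (permP (perm_msets nt)) !count_map count_filter count_map.
apply: eq_count_all (shape_markings t) _ => m /eqP sm /=.
have negbE w : count id w + count negb w = size w := count_predC id w.
case: eqP => cm.
  rewrite andbT -{1}sm; apply: tle_grafted; apply: grafted_pieces => //.
  by have := negbE (inorder m); rewrite cm size_inorder sm nt => /addnI.
(* A marking whose number of marks is not [nodes u] is also excluded on the right, since comparable
   trees have equally many nodes. *)
rewrite andbF; apply/esym/negP => /and3P[/nodes_prune[n1 _] /nodes_tle e1 _].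
by case: cm; rewrite -n1 -e1.
Qed.

(** * Möbius inversion *)

Local Open Scope ring_scope.

(** Measures how much fuel [mu_f] needs at [s]. *)
Definition interval_card (t s : tree) : nat :=
  count (fun r => tle t r && tle r s) (trees_of (nodes t)).

Lemma tle_anti t s : tle t s -> tle s t -> t = s.
Proof.
move=> ts st; apply/eqP; apply: contraT => ne.
have := right_weight_tle ts ne; have := right_weight_tle st; rewrite eq_sym ne.
by move=> /(_ isT) /ltn_trans h /h; rewrite ltnn.
Qed.

Lemma interval_card_lt t r s : tle t r -> tle r s -> r != s ->
  (interval_card t r < interval_card t s)%N.
Proof.
move=> tr rs ne; rewrite /interval_card.
have nrs : ~~ tle s r.
  by apply: contra ne => sr; apply/eqP; apply: tle_anti.
have sT : s \in trees_of (nodes t).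
  by rewrite mem_trees_of -(nodes_tle rs) (nodes_tle tr).
rewrite -!size_filter.
apply: (@uniq_leq_size _ (s :: [seq x <- trees_of (nodes t) | tle t x && tle x r])).
  by rewrite /= filter_uniq ?uniq_trees_of // mem_filter (negbTE nrs) andbF.
move=> x; rewrite inE mem_filter => /orP[/eqP->|/andP[/andP[tx xr] xT]].
  by rewrite mem_filter (tle_trans tr rs) tle_refl.
by rewrite mem_filter tx (tle_trans xr rs).
Qed.

(** Recursive calls go to strictly smaller intervals, so fuel equal to the cardinal already
    suffices. *)
Lemma mu_f_stable k t s : tle t s -> (interval_card t s <= k)%N ->
  mu_f k.+1 t s = mu_f k t s.
Proof.
elim: k s => [|k IHk] s ts.
  (* No fuel would require an empty interval, but [s] belongs to it. *)
  rewrite leqn0 -[_ == _]negbK -lt0n => /negP[]; rewrite /interval_card -has_count.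
  by apply/hasP; exists s; rewrite ?mem_trees_of ?(nodes_tle ts) ?ts ?tle_refl.
move=> le_c; rewrite -[mu_f k.+2 t s]/(if s == t then 1 else if tamari_le t s then
  - \sum_(r <- trees_of (nodes t) | tamari_le t r && tamari_le r s && (r != s))
      mu_f k.+1 t r else 0).
rewrite [RHS]/=; case: eqP => // _; case: ifP => // _; congr (- _).
apply: eq_bigr => r; rewrite !tamari_leE => /andP[/andP[tr rs] ne].
by apply: IHk => //; rewrite -ltnS; apply: leq_trans le_c; apply: interval_card_lt.
Qed.

Lemma mobius_nle t s : ~~ tle t s -> mobius t s = 0.
Proof.
move=> nts; rewrite /mobius /= tamari_leE (negbTE nts).
by case: eqP nts => // ->; rewrite tle_refl.
Qed.

Definition zeta (t s : tree) : rat := (tle t s)%:R.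

Lemma mobius_zeta t s :
  \sum_(r <- trees_of (nodes t)) mobius t r * zeta r s = (t == s)%:R.
Proof.
transitivity (\sum_(r <- trees_of (nodes t) | tle t r && tle r s) mobius t r).
  rewrite [RHS]big_mkcond /=; apply: eq_bigr => r _; rewrite /zeta.
  case: (boolP (tle t r)) => [_|/mobius_nle ->] /=; last by rewrite mul0r.
  by case: (tle r s); rewrite ?mulr1 ?mulr0.
case: (boolP (tle t s)) => ts; last first.
  rewrite big1 => [|r /andP[tr rs]]; last by rewrite (tle_trans tr rs) in ts.
  by case: eqP ts => // ->; rewrite tle_refl.
have sT : s \in trees_of (nodes t) by rewrite mem_trees_of (nodes_tle ts).
rewrite big_mkcond (bigD1_seq s) ?uniq_trees_of //= ts tle_refl /=.
rewrite -big_mkcondl /=.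
have [<-|ne] := eqVneq t s.
  rewrite big1 => [|r /andP[/andP[tr rt]]]; last by rewrite (tle_anti tr rt) eqxx.
  by rewrite /mobius /= eqxx addr0.
(* Unfolding [mobius t s] gives the defining recursion, but with one unit of fuel less in its terms;
   [mu_f_stable] closes this gap. *)
rewrite {1}/mobius /= eq_sym (negbTE ne) tamari_leE ts addrC; apply/eqP.
rewrite subr_eq0; apply/eqP; apply: eq_big => r; rewrite ?tamari_leE //.
by move=> /andP[/andP[tr rs] _]; apply: mu_f_stable => //; apply: count_size.
Qed.

(** If [X] lists coefficients in the [F] basis, its sum over [r <= t] is the coefficient of [M t].
    This change of basis is unitriangular for [right_weight], hence injective. *)
Lemma zeta_inj n (X Y : tree -> rat) :
    (forall t, nodes t = n -> \sum_(r <- trees_of n) X r * zeta r t =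
                              \sum_(r <- trees_of n) Y r * zeta r t) ->
  forall t, nodes t = n -> X t = Y t.
Proof.
move=> h t; have [k] := ubnP (right_weight t); elim: k t => // k IHk t lt nt.
have tT : t \in trees_of n by rewrite mem_trees_of nt.
have := h t nt; rewrite !(bigD1_seq t tT (uniq_trees_of n)) /=.
have -> : \sum_(r <- trees_of n | r != t) X r * zeta r t =
          \sum_(r <- trees_of n | r != t) Y r * zeta r t.
  rewrite big_seq_cond [RHS]big_seq_cond; apply: eq_bigr => r.
  rewrite mem_trees_of /zeta => /andP[/eqP nr ne].
  case: (boolP (tle r t)) => rt; last by rewrite !mulr0.
  by rewrite IHk //; apply: leq_trans (right_weight_tle rt ne) _.
by rewrite /zeta tle_refl !mulr1 => /addIr.
Qed.

(** * Coefficients of products in the two bases *)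

Lemma coefF_M t s : coefF (M t) s = mobius t s.
Proof.
rewrite /coefF /M big_map big_filter /=.
case: (boolP (tle t s)) => ts.
  have sT : s \in trees_of (nodes t) by rewrite mem_trees_of (nodes_tle ts).
  rewrite big_mkcond (bigD1_seq s) ?uniq_trees_of //= tamari_leE ts eqxx.
  by rewrite big1 ?addr0 // => r /negbTE ->; rewrite if_same.
rewrite mobius_nle // big1 // => r; rewrite tamari_leE => tr.
by case: eqP => // e; rewrite -e tr in ts.
Qed.

Lemma sum_M t (h : tree -> rat) :
  \sum_(p <- M t) p.1 * h p.2 = \sum_(r <- trees_of (nodes t)) mobius t r * h r.
Proof.
rewrite big_map big_filter big_mkcond; apply: eq_bigr => r _; rewrite tamari_leE.
by case: (boolP (tle t r)) => // /mobius_nle ->; rewrite mul0r.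
Qed.

Lemma coefF_ymul_M u v s : coefF (ymul (M u) (M v)) s =
  \sum_(u' <- trees_of (nodes u)) mobius u u' *
    \sum_(v' <- trees_of (nodes v)) mobius v v' * (count_mem s (Fprod u' v'))%:R.
Proof.
rewrite /coefF /ymul big_flatten big_allpairs_dep /= -sum_M.
apply: eq_bigr => p _; rewrite -sum_M mulr_sumr; apply: eq_bigr => q _.
by rewrite big_map -big_mkcond /= big_const_seq iter_addr_0 mulrA mulr_natr.
Qed.

Lemma sum_count_mem (n : nat) (T : Type) (f : T -> tree) (h : tree -> rat) l :
    all (fun x => nodes (f x) == n) l ->
  \sum_(r <- trees_of n) (count (fun x => f x == r) l)%:R * h r = \sum_(x <- l) h (f x).
Proof.
elim: l => [_|x l IHl /= /andP[nx /IHl e]].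
  by rewrite big_nil big1 // => r _; rewrite mul0r.
rewrite big_cons -e.
under eq_bigr do rewrite natrD mulrDl.
rewrite big_split /= (bigD1_seq (f x)) ?uniq_trees_of ?mem_trees_of //= eqxx mul1r.
by rewrite big1 ?addr0 // => r /negbTE ne; rewrite eq_sym ne mul0r.
Qed.

Lemma nodes_Fprod u v g : g \in Fprod u v -> nodes g = (nodes u + nodes v)%N.
Proof.
case/mapP=> ms; rewrite mem_msets => /and3P[/eqP sz hp am] ->.
have [] := mset_ofK (leq0n _) hp am; rewrite subn0 sz.
move: (word_of _ _ _) => w e1 e2 e3.
have [_ _] := grafted_nodes (grafted_pieces e2 e3); rewrite e1 => ->.
by rewrite -e2 -e3; apply/esym/count_predC.
Qed.

Lemma natr_count (T : Type) (a : pred T) l :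
  (count a l)%:R = \sum_(x <- l) (a x)%:R :> rat.
Proof.
by rewrite -sum1_count natr_sum big_mkcond; apply: eq_bigr => x _; case: (a x).
Qed.

(** The coefficient of [M t] in the product of [F u] and [F v]; this is [count_tle_graft] in
    algebraic form. *)
Lemma Fprod_zeta u v t : nodes t = (nodes u + nodes v)%N ->
  \sum_(s <- trees_of (nodes u + nodes v)) (count_mem s (Fprod u v))%:R * zeta s t =
  \sum_(m <- markings t | admissible m) zeta u (prune m).1 * zeta v (prune m).2.
Proof.
move=> nt; rewrite (sum_count_mem (f := id) (zeta^~ t)); last first.
  by apply/allP => g /nodes_Fprod /= ->.
rewrite big_map -natr_count count_tle_graft // natr_count [RHS]big_mkcond.
by apply: eq_bigr => m _; rewrite /zeta -natrM mulnb; case: (admissible m).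
Qed.

(* Delta(M*_t) = sum_S M*_{t'_S} (x) M*_{t''_S}  in LR = graded dual of YSym,
   i.e. (coproduct of LR dual to the product of YSym) for all trees u, v:
   M_u . M_v = sum_t #{S admissible in t : t'_S = u, t''_S = v} M_t,
   compared coefficientwise in the F-basis. *)
Theorem theorem8p4 (u v : tree) (s : tree) :
  coefF (ymul (M u) (M v)) s =
  \sum_(t <- trees_of (nodes u + nodes v))
     (count (fun m => admissible m && (prune m == (u, v))) (markings t))%:R
       * coefF (M t) s.
Proof.
(* Both sides are homogeneous, so they vanish at [s] of any other degree. *)
have [ns|ns] := eqVneq (nodes s) (nodes u + nodes v)%N; last first.
  rewrite coefF_ymul_M !big_seq big1 => [|u' /[!mem_trees_of]/eqP nu].
    rewrite big1 // => t; rewrite mem_trees_of coefF_M => /eqP nt.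
    rewrite mobius_nle ?mulr0 //; apply: contra ns => /nodes_tle <-.
    by rewrite nt.
  rewrite big_seq big1 ?mulr0 // => v' /[!mem_trees_of]/eqP nv.
  rewrite (count_memPn _) ?mulr0 //; apply: contra ns => /nodes_Fprod ->.
  by rewrite nu nv.
(* From here on the coefficients of [M t] are compared. *)
move: s ns; apply: zeta_inj => t nt.
under eq_bigr do rewrite coefF_ymul_M mulr_suml.
rewrite exchange_big /=.
transitivity (\sum_(m <- markings t | admissible m)
    (u == (prune m).1)%:R * (v == (prune m).2)%:R : rat).
  (* Each indicator is expanded back into a Möbius sum, over [u'] or [v']; for fixed [u'] and [v']
     the remaining sum over markings is that of [Fprod_zeta]. *)
  under [RHS]eq_bigr do rewrite -!mobius_zeta mulr_suml.
  rewrite [RHS]exchange_big /= big_seq [RHS]big_seq; apply: eq_bigr => u'.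
  rewrite mem_trees_of => /eqP nu.
  under eq_bigr do rewrite -mulrA mulr_suml.
  rewrite -mulr_sumr exchange_big /=.
  under [RHS]eq_bigr do rewrite -mulrA mulr_sumr.
  rewrite -mulr_sumr; congr (_ * _).
  rewrite [RHS]exchange_big /= big_seq [RHS]big_seq; apply: eq_bigr => v'.
  rewrite mem_trees_of => /eqP nv.
  under eq_bigr do rewrite -mulrA.
  under [RHS]eq_bigr do rewrite mulrCA.
  by rewrite -!mulr_sumr -nu -nv Fprod_zeta // nu nv.
(* On the right, [mobius_zeta] keeps only the term indexed by [t] itself, whose multiplicity is the
   same count of markings. *)
under [RHS]eq_bigr do rewrite mulr_suml.
rewrite exchange_big /=.
have tT : t \in trees_of (nodes u + nodes v) by rewrite mem_trees_of nt.
rewrite (bigD1_seq t) ?uniq_trees_of //= [X in _ + X]big1_seq ?addr0.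
  under [RHS]eq_bigr do rewrite coefF_M -mulrA.
  rewrite -mulr_sumr -nt mobius_zeta eqxx mulr1 natr_count big_mkcond.
  apply: eq_bigr => m _; case: (admissible m) => //=.
  by rewrite -natrM mulnb eq_sym; case: (prune m) => a b; rewrite xpair_eqE (eq_sym v).
move=> t' /andP[ne]; rewrite mem_trees_of => /eqP nt'.
under eq_bigr do rewrite coefF_M -mulrA.
by rewrite -mulr_sumr -nt' mobius_zeta (negbTE ne) mulr0.
Qed.
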